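(* Let $d=331914313984493$, let $K=\mathbb{Q}(\sqrt{d})$, let $\omega=\frac{1+\sqrt{d}}{2}$, let $\varepsilon>1$ be the fundamental unit of the ring of integers $\mathcal{O}_K$ of $K$, and let $x,y\in\mathbb{N}_0$ be the unique nonnegative integers with $\varepsilon=x+y\omega$. Then $d\equiv 1\mod 4$, $d$ is a prime number, and $d\mid y$.
   Context: Since $d\equiv 1\mod 4$ and $d$ is squarefree, $\mathcal{O}_K=\mathbb{Z}[\omega]=\mathbb{Z}\oplus\omega\mathbb{Z}$. The fundamental unit $\varepsilon>1$ is the element of $\mathcal{O}_K$ with $\varepsilon>1$ such that the unit group of $\mathcal{O}_K$ equals $\{\pm\varepsilon^k:k\in\mathbb{Z}\}$. *)

(* Defs.v *)
From Stdlib Require Import BinNat.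
From mathcomp Require Import all_boot all_order all_algebra all_field.

Set Implicit Arguments.
Unset Strict Implicit.
Unset Printing Implicit Defensive.

Import Order.TTheory GRing.Theory Num.Theory.
Local Open Scope ring_scope.

(* The literal is a binary number, injected into nat by nat_of_bin; it must not
   be reduced to a unary numeral. *)
Definition d : nat := nat_of_bin 331914313984493%num.
Arguments d : simpl never.

(* sqrtC is the nonnegative square root on nonnegative reals. *)
Definition sqrtd : algC := sqrtC d%:R.

Definition omega : algC := (1 + sqrtd) / 2%:R.

(* K = Q(sqrt d) inside algC: the intersection of all subfields of algC
   containing sqrt d (such subfields automatically contain Q).  As 0^-1 = 0 in
   algC, the predicates closed under 1, subtraction and division are exactly
   the subfields. *)
Definition in_K (z : algC) : Prop :=
  forall S : {pred algC}, GRing.divring_closed S -> sqrtd \in S -> z \in S.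

Definition in_OK (z : algC) : Prop := in_K z /\ z \in Aint.

Definition unit_OK (u : algC) : Prop :=
  in_OK u /\ exists2 v : algC, in_OK v & u * v = 1.

(* The order of algC is partial: 1 < e entails that e is real. *)
Definition fundamental_unit (e : algC) : Prop :=
  [/\ in_OK e, 1 < e &
      forall u : algC, unit_OK u <-> exists k : int, u = e ^ k \/ u = - e ^ k].

(* Main.v *)
Require Import Defs.
From HB Require Import structures.
From Stdlib Require Import ZArith.
From mathcomp Require Import all_boot all_order all_algebra all_field.
From mathcomp Require Import cyclic zify ssrZ ring.

Set Implicit Arguments.
Unset Strict Implicit.
Unset Printing Implicit Defensive.

Import Order.TTheory GRing.Theory Num.Theory.

(* The fundamental unit has about 760000 digits, so a unit lam > 1 is given in
   compact form, as the last term of lam_(j+1) = g_j * lam_j ^ 2 with lam_0 = 2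
   and fifteen small g_j in K.  It is a unit because lam_j generates an ideal
   I_j with I_(j+1) = g_j * I_j ^ 2, where I_0 = (2) and I_15 = (1); each of
   these equalities is certified by integer coefficients.  Modulo the square of
   the ramified prime above d, (a + b sqrt d) |-> b / a is additive, so the
   congruence d | b can be followed along the chain, and it holds for lam.
   Finally lam = eps ^ k with 0 < k < d because 2 <= eps and lam <= 2 ^ m for
   some m < d; hence b / a vanishes modulo d for eps as well. *)

(** * Pocklington's primality criterion *)

(** Bezout gives [u * e = v * f + gcdn e f], and both [a ^ (u * e)] and [a ^ (v * f)] are 1 modulo
    [p]. *)
Lemma expn_gcdn_mod1 (p a e f : nat) : 0 < e ->
  a ^ e = 1 %[mod p] -> a ^ f = 1 %[mod p] -> a ^ gcdn e f = 1 %[mod p].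
Proof.
move=> e_gt0 ae af; have [u v def_u _] := egcdnP f e_gt0.
have pow1 w g : a ^ g = 1 %[mod p] -> a ^ (w * g) = 1 %[mod p].
  by move=> ag; rewrite mulnC expnM -modnXm ag modnXm exp1n.
have := pow1 u _ ae.
by rewrite def_u expnD -modnMml (pow1 _ _ af) modnMml mul1n.
Qed.

(** The last hypothesis says, without subtraction, that [u] inverts [a ^ (n.-1 %/ r) - 1] modulo
    [n]. If [n] is composite, it has a prime factor [p] with [p ^ 2 <= n]; every [r] divides [p.-1],
    so the product of the [r] is less than [p], which contradicts its size. *)
Lemma pocklington (n a : nat) (rs : seq nat) :
    1 < n -> uniq rs -> all prime rs -> all (fun r => r %| n.-1) rs ->
    n <= (\prod_(r <- rs) r) ^ 2 -> a ^ n.-1 = 1 %[mod n] ->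
    {in rs, forall r, exists u, u * a ^ (n.-1 %/ r) = u.+1 %[mod n]} ->
  prime n.
Proof.
move=> n_gt1 uniq_rs /allP prime_rs /allP dvd_rs le_n an ar.
have n1_gt0 : 0 < n.-1 by rewrite -ltnS prednK ?(ltnW n_gt1).
apply: contraT => /primePns[|[p [p_pr le_p p_dvd]]]; first by rewrite ltnNge n_gt1.
have modp x y : x = y %[mod n] -> x = y %[mod p].
  by move=> xy; rewrite -(modn_dvdm x p_dvd) xy modn_dvdm.
have a_cop : coprime a p.
  rewrite coprime_sym prime_coprime //; apply/negP => p_a.
  have /modp := an.
  by rewrite (eqP (dvdn_exp n1_gt0 p_a)) modn_small ?prime_gt1.
have ap : a ^ p.-1 = 1 %[mod p].
  by rewrite -totient_prime //; apply: Euler_exp_totient.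
have r_dvd r : r \in rs -> r %| p.-1.
  move=> r_rs; apply: contraT => r_ndvd.
  have [u /modp] := ar r r_rs.
  have ap' : a ^ (n.-1 %/ r) = 1 %[mod p].
    (* If [r] does not divide [p.-1], it is coprime to the gcd, which divides
       [n.-1 = r * (n.-1 %/ r)]; Gauss' lemma removes [r]. *)
    have dv : gcdn n.-1 p.-1 %| n.-1 %/ r.
      rewrite -(@Gauss_dvdr _ r); last first.
        rewrite coprime_sym prime_coprime ?prime_rs //.
        by apply: contra r_ndvd => /dvdn_trans-> //; apply: dvdn_gcdr.
      by rewrite mulnC (divnK (dvd_rs r r_rs)) dvdn_gcdl.
    rewrite -(divnK dv) mulnC expnM -modnXm expn_gcdn_mod1 //; last exact: modp.
    by rewrite modnXm exp1n.
  rewrite -modnMmr ap' modnMmr muln1 -[u in LHS]addn0 -addn1 => /eqP.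
  by rewrite eqn_modDl mod0n modn_small ?prime_gt1.
have F_dvd : \prod_(r <- rs) r %| p.-1.
  elim: rs uniq_rs prime_rs r_dvd {dvd_rs le_n ar} => [|r s IHs] /=.
    by rewrite big_nil dvd1n.
  case/andP=> r_s uniq_s prime_s dvd_s; rewrite big_cons Gauss_dvd.
    by rewrite dvd_s ?mem_head // IHs // => t t_s;
      [apply: prime_s | apply: dvd_s]; rewrite inE t_s orbT.
  rewrite big_seq; elim/big_ind: _ => [|x y cx cy|t t_s]; first exact: coprimen1.
    by rewrite coprimeMr cx.
  rewrite prime_coprime ?prime_s ?mem_head // dvdn_prime2 ?prime_s ?mem_head //.
    by apply: contraNneq r_s => ->.
  by rewrite inE t_s orbT.
have p1_gt0 : 0 < p.-1 by rewrite -ltnS prednK ?prime_gt0 ?prime_gt1.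
have := dvdn_leq p1_gt0 F_dvd; rewrite -ltnS prednK ?prime_gt0 // => F_lt.
by have := leq_trans le_p le_n; rewrite leq_exp2r // leqNgt F_lt.
Qed.

(** * Binary arithmetic and an executable Pocklington test *)

Lemma nat_of_bin_add (x y : N) :
  nat_of_bin (N.add x y) = nat_of_bin x + nat_of_bin y.
Proof. lia. Qed.

Lemma nat_of_bin_mul (x y : N) :
  nat_of_bin (N.mul x y) = nat_of_bin x * nat_of_bin y.
Proof. lia. Qed.

Lemma nat_of_bin_lt (x y : N) : (nat_of_bin x < nat_of_bin y) = N.ltb x y.
Proof. lia. Qed.

Lemma nat_of_bin_divmod (x y : N) : nat_of_bin x =
  nat_of_bin (N.div x y) * nat_of_bin y + nat_of_bin (N.modulo x y).
Proof. by rewrite {1}(N.Div0.div_mod x y); lia. Qed.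

Lemma nat_of_bin_mod (x y : N) :
  nat_of_bin (N.modulo x y) = nat_of_bin x %% nat_of_bin y.
Proof.
case: y => [|y]; first by rewrite modn0; case: x.
have lt_mod : N.lt (N.modulo x (N.pos y)) (N.pos y) by apply: N.mod_lt.
by rewrite [in RHS](nat_of_bin_divmod x (N.pos y)) modnMDl modn_small //; lia.
Qed.

Lemma nat_of_bin_div (x y : N) :
  nat_of_bin (N.div x y) = nat_of_bin x %/ nat_of_bin y.
Proof.
case: y => [|y]; first by rewrite divn0; case: x.
have lt_mod : N.lt (N.modulo x (N.pos y)) (N.pos y) by apply: N.mod_lt.
rewrite [in RHS](nat_of_bin_divmod x (N.pos y)) divnMDl ?divn_small ?addn0 //; lia.
Qed.

Fixpoint powmod_pos (n a : N) (e : positive) : N :=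
  match e with
  | xH => N.modulo a n
  | xO e' => let b := powmod_pos n a e' in N.modulo (N.mul b b) n
  | xI e' =>
      let b := powmod_pos n a e' in N.modulo (N.mul a (N.mul b b)) n
  end.

Definition powmod (n a e : N) : N :=
  if e is Npos p then powmod_pos n a p else N.modulo 1 n.

Lemma powmodE (n a e : N) :
  nat_of_bin (powmod n a e) =
  nat_of_bin a ^ nat_of_bin e %% nat_of_bin n.
Proof.
case: e => [|e] /=; first by rewrite nat_of_bin_mod expn0.
elim: e => [e IHe|e IHe|] /=.
- rewrite nat_of_bin_mod !nat_of_bin_mul IHe NatTrec.doubleE expnS -addnn expnD.
  by rewrite -modnMmr modnMm modnMmr.
- by rewrite nat_of_bin_mod nat_of_bin_mul IHe NatTrec.doubleE -addnn expnD modnMm.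
- by rewrite nat_of_bin_mod expn1.
Qed.

(** Each pair holds a factor [r] of [n - 1] and the inverse of [a ^ ((n - 1) / r) - 1] modulo [n].
    Primality of the factors is established separately, so that certificates can be nested. *)
Definition pocklington_check (n a : N) (rus : seq (N * N)) : bool :=
  [&& N.ltb 1 n, uniq (unzip1 rus),
      N.leb n (N.pow (foldr N.mul 1%num (unzip1 rus)) 2),
      N.eqb (powmod n a (N.pred n)) 1 &
      all (fun ru => N.eqb (N.modulo (N.pred n) ru.1) 0 &&
        N.eqb (N.modulo (N.mul ru.2 (powmod n a (N.div (N.pred n) ru.1))) n)
              (N.modulo (N.succ ru.2) n)) rus].

Lemma pocklington_checkP (n a : N) (rus : seq (N * N)) :
    {in unzip1 rus, forall r, prime (nat_of_bin r)} ->
  pocklington_check n a rus -> prime (nat_of_bin n).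
Proof.
move=> prime_rs /and5P[n_gt1 uniq_rs le_n /N.eqb_spec an /allP us].
have predE x : nat_of_bin (N.pred x) = (nat_of_bin x).-1 by lia.
have succE x : nat_of_bin (N.succ x) = (nat_of_bin x).+1 by lia.
have n_gt1' : 1 < nat_of_bin n by lia.
apply: (@pocklington _ (nat_of_bin a) [seq nat_of_bin r | r <- unzip1 rus]) => //.
- by rewrite map_inj_uniq //; apply: can_inj nat_of_binK.
- by apply/allP => _ /mapP[r r_rs ->]; apply: prime_rs.
- apply/allP => _ /mapP[_ /mapP[ru ru_rs ->] ->].
  have /andP[/N.eqb_spec r_dvd _] := us _ ru_rs.
  by rewrite /dvdn -predE -nat_of_bin_mod r_dvd.
- have ->: \prod_(r <- [seq nat_of_bin r | r <- unzip1 rus]) r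
           = nat_of_bin (foldr N.mul 1%num (unzip1 rus)).
    elim: (unzip1 rus) => [|r s IHs] /=; first by rewrite big_nil.
    by rewrite big_cons IHs nat_of_bin_mul.
  move: le_n; set f := foldr _ _ _; lia.
- rewrite -predE -[LHS]powmodE an modn_small //.
- move=> _ /mapP[_ /mapP[ru ru_rs ->] ->]; exists (nat_of_bin ru.2).
  have /andP[_ /N.eqb_spec /(congr1 nat_of_bin)] := us _ ru_rs.
  rewrite !nat_of_bin_mod nat_of_bin_mul powmodE modnMmr.
  by rewrite nat_of_bin_div predE succE.
Qed.

(** * Primality of [d] and its residue modulo 4 *)

Lemma prime_4591 : prime (nat_of_bin 4591).
Proof.
apply: (@pocklington_checkP _ 2%num [:: (5, 224); (17, 363)]%num).
  by move=> r; rewrite !inE => /orP[]/eqP->.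
by vm_compute.
Qed.

Lemma prime_68821 : prime (nat_of_bin 68821).
Proof.
apply: (@pocklington_checkP _ 2%num [:: (31, 61256); (37, 16725)]%num).
  by move=> r; rewrite !inE => /orP[]/eqP->.
by vm_compute.
Qed.

Lemma prime_2242664283679 : prime (nat_of_bin 2242664283679).
Proof.
apply: (@pocklington_checkP _ 2%num
  [:: (4591, 2076836659123); (68821, 1122788298130)]%num).
  by move=> r; rewrite !inE => /orP[]/eqP->;
    [exact: prime_4591 | exact: prime_68821].
by vm_compute.
Qed.

(** Here [d - 1 = 148 * 2242664283679], so this single prime factor already exceeds the square root
    of [d]. *)
Lemma prime_d : prime d.
Proof.
apply: (@pocklington_checkP _ 2%num [:: (2242664283679, 188538815787634)]%num).
  by move=> r; rewrite !inE => /eqP->; exact: prime_2242664283679.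
by vm_compute.
Qed.

Lemma d_mod4 : d = 1 %[mod 4].
Proof.
have -> : d = nat_of_bin 82978578496123 * 4 + 1.
  rewrite /d -(nat_of_bin_mul _ 4) -(nat_of_bin_add _ 1); congr nat_of_bin.
by rewrite modnMDl.
Qed.

(** * Binary integers in [algC], and size and minimal equation of [omega] *)

Local Open Scope ring_scope.
Delimit Scope Z_scope with coqZ.

Arguments Z.mul : simpl never.
Arguments Z.add : simpl never.

(* Locked, since unfolding it on large literals would produce unary numbers. *)
HB.lock Definition ZtoC (z : Z) : algC := (int_of_Z z)%:~R.

Lemma ZtoCD x y : ZtoC (x + y)%coqZ = ZtoC x + ZtoC y.
Proof. by rewrite ZtoC.unlock (raddfD int_of_Z) rmorphD. Qed.

Lemma ZtoCM x y : ZtoC (x * y)%coqZ = ZtoC x * ZtoC y.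
Proof. by rewrite ZtoC.unlock (rmorphM int_of_Z) rmorphM. Qed.

Lemma ZtoC1 : ZtoC 1 = 1. Proof. by rewrite ZtoC.unlock. Qed.

Lemma ZtoC0 : ZtoC 0 = 0. Proof. by rewrite ZtoC.unlock. Qed.

Lemma ler_ZtoC x y : (ZtoC x <= ZtoC y) = Z.leb x y.
Proof. by rewrite ZtoC.unlock ler_int; lia. Qed.

Lemma ZtoC_nat (b : N) : ZtoC (Z.of_N b) = (nat_of_bin b)%:R.
Proof.
rewrite ZtoC.unlock; have -> : int_of_Z (Z.of_N b) = Posz (nat_of_bin b) by lia.
by [].
Qed.

Lemma ZtoC_pow2 (n : N) : ZtoC (2 ^ Z.of_N n)%coqZ = 2 ^+ nat_of_bin n.
Proof.
have -> : (2 ^ Z.of_N n)%coqZ = Z.of_N (2 ^ n)%num by rewrite N2Z.inj_pow.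
rewrite ZtoC_nat -natrX; congr (_%:R); lia.
Qed.

Definition dZ : Z := 331914313984493.
(** This is [(d - 1) / 4]; [omega] is a root of [X^2 - X - mZ]. *)
Definition mZ : Z := 82978578496123.

Lemma ZtoC_d : ZtoC dZ = d%:R.
Proof. exact: (ZtoC_nat 331914313984493). Qed.

Lemma sqr_sqrtd : sqrtd ^+ 2 = ZtoC dZ.
Proof. by rewrite /sqrtd sqrtCK ZtoC_d. Qed.

Lemma sqr_omega : omega ^+ 2 = ZtoC mZ + omega.
Proof.
have ZtoC4 : ZtoC 4 = 4 by exact: (ZtoC_nat 4).
have : ZtoC dZ = 4 * ZtoC mZ + 1 by rewrite -ZtoC4 -ZtoC1 -ZtoCM -ZtoCD.
rewrite -sqr_sqrtd /omega => dE.
have two_neq0 : (2 : algC) != 0 by rewrite pnatr_eq0.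
by rewrite exprMn sqrrD dE; field.
Qed.

Lemma omega_bounds : 0 <= omega <= ZtoC (2 ^ 24)%coqZ.
Proof.
have s_ge0 : 0 <= sqrtd by rewrite sqrtC_ge0 ler0n.
(* The bound [2 ^ 25 - 1] is chosen so that [(1 + sqrtd) / 2 <= 2 ^ 24]. *)
have s_le : sqrtd <= ZtoC (2 ^ 25 - 1)%coqZ.
  have p_ge0 : 0 <= ZtoC (2 ^ 25 - 1)%coqZ by rewrite -ZtoC0 ler_ZtoC.
  rewrite -(@ler_pXn2r _ 2) ?nnegrE //.
  by rewrite sqr_sqrtd expr2 -ZtoCM ler_ZtoC.
have ZtoC2 : ZtoC 2 = 2 by exact: (ZtoC_nat 2).
have two_gt0 : 0 < (2 : algC) by rewrite ltr0n.
apply/andP; split; first by rewrite divr_ge0 ?addr_ge0 ?ler01 ?ler0n.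
rewrite /omega ler_pdivrMr // -ZtoC2 -ZtoC1 -ZtoCM.
apply: le_trans (lerD (lexx _) s_le) _.
by rewrite -ZtoCD ler_ZtoC.
Qed.

Lemma omega_ge2 : 2 <= omega.
Proof.
have ZtoC3 : ZtoC 3 = 3 by exact: (ZtoC_nat 3).
have s_ge3 : 3 <= sqrtd.
  have s_ge0 : 0 <= sqrtd by rewrite sqrtC_ge0 ler0n.
  rewrite -(@ler_pXn2r _ 2) ?nnegrE ?ler0n //.
  by rewrite sqr_sqrtd -ZtoC3 expr2 -ZtoCM ler_ZtoC.
rewrite /omega ler_pdivlMr ?ltr0n //.
have -> : 2 * 2 = 1 + 3 :> algC by ring.
by rewrite lerD2l.
Qed.

(** * Arithmetic of [Z[omega]] in coordinates *)

Definition ev (x : Z * Z) : algC := ZtoC x.1 + ZtoC x.2 * omega.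

Definition addO (x y : Z * Z) : Z * Z := (x.1 + y.1, x.2 + y.2)%coqZ.

Definition scaleO (c : Z) (x : Z * Z) : Z * Z := (c * x.1, c * x.2)%coqZ.

Definition mulO (x y : Z * Z) : Z * Z :=
  (x.1 * y.1 + mZ * (x.2 * y.2), x.1 * y.2 + (x.2 * y.1 + x.2 * y.2))%coqZ.

Definition eqO (x y : Z * Z) : bool := Z.eqb x.1 y.1 && Z.eqb x.2 y.2.

Lemma evD x y : ev (addO x y) = ev x + ev y.
Proof. rewrite /ev /= !ZtoCD; ring. Qed.

Lemma evZ c x : ev (scaleO c x) = ZtoC c * ev x.
Proof. rewrite /ev /= !ZtoCM; ring. Qed.

Lemma evM x y : ev (mulO x y) = ev x * ev y.
Proof.
rewrite /ev /= !(ZtoCD, ZtoCM); move: (ZtoC mZ) omega sqr_omega => m w w2.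
ring: w2.
Qed.

Lemma eqOP x y : eqO x y -> x = y.
Proof. by case: x y => [a b] [a' b'] /andP[/Z.eqb_spec /= -> /Z.eqb_spec /= ->]. Qed.

(** * Certified squaring steps on principal ideals *)

(** Equality of the [Z[omega]]-modules generated by [u, v] and by [lam], with explicit cofactors. *)
Definition generates (lam u v : algC) : Prop :=
  exists r1 r2 s1 s2 : Z * Z,
    [/\ u = lam * ev r1, v = lam * ev r2 & lam = ev s1 * u + ev s2 * v].

Definition comb (s : Z * Z * Z) (x y z : Z * Z) : Z * Z :=
  addO (scaleO s.1.1 x) (addO (scaleO s.1.2 y) (scaleO s.2 z)).

(* With h = A + B omega, u' = a and v' = b + omega, a step certifies
   (h / C) * (u, v) ^ 2 = (u', v') as ideals; S and T express C * u' and C * v'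
   in terms of h * u ^ 2, h * u * v and h * v ^ 2, while [in_span] recovers the
   opposite coefficients by division. *)
Record step := Step {
  step_a : Z; step_b : Z; step_A : Z; step_B : Z; step_C : Z;
  step_S : Z * Z * Z; step_T : Z * Z * Z }.

Definition next_u (c : step) : Z * Z := (step_a c, 0%coqZ).
Definition next_v (c : step) : Z * Z := (step_b c, 1%coqZ).

(** Only [v'] has an [omega]-part, so that coordinate determines [q], and the other one then
    determines [p]. Rounding in the divisions is harmless because the resulting equality is
    tested. *)
Definition in_span (c : step) (x : Z * Z) : bool :=
  let q := (x.2 / step_C c)%coqZ in
  let p := ((x.1 / step_C c - q * step_b c) / step_a c)%coqZ in
  eqO x (scaleO (step_C c) (addO (scaleO p (next_u c)) (scaleO q (next_v c)))).

Lemma in_spanP c x : in_span c x ->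
  exists p q : Z, ev x = ZtoC (step_C c) *
    (ZtoC p * ev (next_u c) + ZtoC q * ev (next_v c)).
Proof.
by move=> /eqOP/(congr1 ev); rewrite evZ evD !evZ => xE; do 2!eexists; exact: xE.
Qed.

(** The first three conjuncts certify the ideal equality. The last two keep the multiplier [h / C]
    between 1 and [2 ^ 144], by means of [omega <= 2 ^ 24]. *)
Definition step_ok (u v : Z * Z) (c : step) : bool :=
  let h := (step_A c, step_B c) in
  let uu := mulO h (mulO u u) in
  let uv := mulO h (mulO u v) in
  let vv := mulO h (mulO v v) in
  [&& [&& in_span c uu, in_span c uv & in_span c vv],
      eqO (scaleO (step_C c) (next_u c)) (comb (step_S c) uu uv vv),
      eqO (scaleO (step_C c) (next_v c)) (comb (step_T c) uu uv vv),
      [&& Z.leb 1 (step_C c), Z.leb (step_C c) (step_A c) & Z.leb 1 (step_B c)] &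
      Z.leb (step_A c + step_B c * 2 ^ 24)%coqZ (2 ^ 144)].

Definition step_elt (c : step) : algC :=
  ev (step_A c, step_B c) / ZtoC (step_C c).

Lemma ZtoC_gt0 z : Z.leb 1 z -> 0 < ZtoC z.
Proof. by rewrite -ler_ZtoC ZtoC1; apply: lt_le_trans. Qed.

(** From [(u, v) = (lam)] follows [(u^2, u v, v^2) = (lam^2)]; multiplying by [h / C] gives
    [(u', v')]. *)
Lemma generates_step (u v : Z * Z) (c : step) (lam : algC) :
  step_ok u v c -> generates lam (ev u) (ev v) ->
  generates (step_elt c * lam ^+ 2) (ev (next_u c)) (ev (next_v c)).
Proof.
case/and5P=> /and3P[/in_spanP[p1 [q1 uu]] /in_spanP[p2 [q2 uv]]].
move=> /in_spanP[p3 [q3 vv]] /eqOP/(congr1 ev) Su /eqOP/(congr1 ev) Tv.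
case/and3P=> /ZtoC_gt0 C_gt0 _ _ _ [r1 [r2 [s1 [s2 [uE vE lamE]]]]].
have C_neq0 : ZtoC (step_C c) != 0 by rewrite gt_eqF.
move: Su Tv uu uv vv; rewrite !(evZ, evD, evM) /step_elt.
set h := ev (step_A c, _); set C := ZtoC _ in C_neq0 *.
set u' := ev (next_u c); set v' := ev (next_v c).
case: (step_S c) (step_T c) => [[x1 x2] x3] [[y1 y2] y3] /= Su Tv uu uv vv.
(* Substitute [u = lam * r1] and [v = lam * r2] in the expressions of [u'] and [v'] by [S] and
   [T]. *)
exists (addO (scaleO x1 (mulO r1 r1))
         (addO (scaleO x2 (mulO r1 r2)) (scaleO x3 (mulO r2 r2)))).
exists (addO (scaleO y1 (mulO r1 r1))
         (addO (scaleO y2 (mulO r1 r2)) (scaleO y3 (mulO r2 r2)))).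
(* Expand [lam^2 = (s1 u + s2 v)^2] and rewrite the three products in terms of [u'] and [v']. *)
exists (addO (scaleO p1 (mulO s1 s1))
  (addO (scaleO (2 * p2) (mulO s1 s2)) (scaleO p3 (mulO s2 s2)))).
exists (addO (scaleO q1 (mulO s1 s1))
  (addO (scaleO (2 * q2) (mulO s1 s2)) (scaleO q3 (mulO s2 s2)))).
have ZtoC2 : ZtoC 2 = 2 by exact: (ZtoC_nat 2).
split; rewrite !(evZ, evD, evM, ZtoCM) ?ZtoC2; apply: (mulfI C_neq0).
- rewrite Su uE vE; field; exact: C_neq0.
- rewrite Tv uE vE; field; exact: C_neq0.
- transitivity (h * (ev s1 * ev u + ev s2 * ev v) ^+ 2).
    by rewrite -lamE; field.
  transitivity (ev s1 ^+ 2 * (h * (ev u * ev u))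
    + 2 * (ev s1 * ev s2) * (h * (ev u * ev v)) + ev s2 ^+ 2 * (h * (ev v * ev v))).
    by ring.
  by rewrite uu uv vv; ring.
Qed.

Lemma step_elt_bounds (u v : Z * Z) (c : step) :
  step_ok u v c -> 1 <= step_elt c <= 2 ^+ 144.
Proof.
case/and5P=> _ _ _ /and3P[C_ge1 CA /ZtoC_gt0 /ltW B_ge0] AB.
have C_gt0 := ZtoC_gt0 C_ge1.
have /andP[w_ge0 w_le] := omega_bounds.
rewrite /step_elt ler_pdivlMr // mul1r ler_pdivrMr //; apply/andP; split.
  rewrite /ev /= -[leLHS]addr0; apply: lerD; first by rewrite ler_ZtoC.
  exact: mulr_ge0.
have : ev (step_A c, step_B c) <= 2 ^+ 144.
  rewrite -[144%N]/(nat_of_bin 144) -ZtoC_pow2.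
  rewrite -ler_ZtoC in AB; apply: le_trans AB.
  by rewrite ZtoCD ZtoCM lerD // ler_wpM2l.
move=> /le_trans; apply; rewrite ler_peMr ?exprn_ge0 ?ler0n //.
by rewrite -ZtoC1 ler_ZtoC.
Qed.

(** * The ratio [b / a] modulo [d] along a step *)

(* Up to a rational factor, lam is congruent to a + b sqrtd modulo the square
   of the prime (sqrtd) above d. *)
Definition dlog_rep (lam : algC) (a b : Z) : Prop :=
  exists c a' b' : Z,
    ZtoC c * lam = ZtoC (a + dZ * a')%coqZ + ZtoC (b + dZ * b')%coqZ * sqrtd.

(** Coordinates modulo [d] of [(2A + B + B sqrtd) * (a + b sqrtd)^2], where the first factor is
    twice [A + B omega]. *)
Definition next_da (c : step) (a b : Z) : Z :=
  ((2 * step_A c + step_B c) * (a * a) mod dZ)%coqZ.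
Definition next_db (c : step) (a b : Z) : Z :=
  (((2 * step_A c + step_B c) * (2 * (a * b)) + step_B c * (a * a)) mod dZ)%coqZ.

Lemma dlog_rep_mod lam a b : dlog_rep lam a b ->
  dlog_rep lam (a mod dZ)%coqZ (b mod dZ)%coqZ.
Proof.
move=> [c [a' [b' lamE]]]; exists c, (a / dZ + a')%coqZ, (b / dZ + b')%coqZ.
by rewrite lamE {1}(Z.div_mod a dZ) // {1}(Z.div_mod b dZ) //;
   congr (ZtoC _ + ZtoC _ * _); lia.
Qed.

Lemma dlog_rep_step (c : step) (lam : algC) (a b : Z) :
  ZtoC (step_C c) != 0 -> dlog_rep lam a b ->
  dlog_rep (step_elt c * lam ^+ 2) (next_da c a b) (next_db c a b).
Proof.
move=> C_neq0 [k [a' [b' lamE]]]; apply: dlog_rep_mod.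
have two_neq0 : (2 : algC) != 0 by rewrite pnatr_eq0.
have ZtoC2 : ZtoC 2 = 2 by exact: (ZtoC_nat 2).
pose P := (2 * step_A c + step_B c)%coqZ; pose Q := step_B c.
pose a1 := (a + dZ * a')%coqZ; pose b1 := (b + dZ * b')%coqZ.
(* This factor clears the 2 of [omega], the denominator of the step and that of [lam ^+ 2]. The next
   two witnesses collect the multiples of [d] in the two coordinates. *)
exists (2 * step_C c * (k * k))%coqZ.
exists (P * (2 * a * a' + dZ * (a' * a') + b1 * b1) + Q * (2 * a1 * b1))%coqZ.
exists (P * (2 * (a * b' + a' * b + dZ * a' * b'))
        + Q * (2 * a * a' + dZ * (a' * a') + b1 * b1))%coqZ.
transitivity ((ZtoC P + ZtoC Q * sqrtd) * (ZtoC k * lam) ^+ 2).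
  rewrite /step_elt /ev /P /Q /omega !(ZtoCM, ZtoCD) ZtoC2 /=.
  by field; rewrite C_neq0.
rewrite lamE -/a1 -/b1.
transitivity (ZtoC (P * (a1 * a1 + dZ * (b1 * b1)) + Q * (dZ * (2 * (a1 * b1))))%coqZ
  + ZtoC (P * (2 * (a1 * b1)) + Q * (a1 * a1 + dZ * (b1 * b1)))%coqZ * sqrtd).
  rewrite !(ZtoCM, ZtoCD) ZtoC2.
  by move: (ZtoC dZ) sqrtd sqr_sqrtd => D s s2; ring: s2.
by congr (ZtoC _ + ZtoC _ * _); rewrite -/P -/Q /a1 /b1; move: dZ P Q => D P Q; ring.
Qed.

(** * Running the chain that represents the unit *)

(* [st_m] bounds the base 2 logarithm of the current generator. *)
Record state := State {
  st_u : Z * Z; st_v : Z * Z; st_da : Z; st_db : Z; st_m : N }.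

Definition valid (s : state) (lam : algC) : Prop :=
  [/\ 1 < lam, lam <= 2 ^+ nat_of_bin (st_m s),
      generates lam (ev (st_u s)) (ev (st_v s)) &
      dlog_rep lam (st_da s) (st_db s)].

Definition next (s : state) (c : step) : state :=
  State (next_u c) (next_v c) (next_da c (st_da s) (st_db s))
    (next_db c (st_da s) (st_db s)) (2 * st_m s + 144)%num.

Lemma valid_next s c lam : step_ok (st_u s) (st_v s) c -> valid s lam ->
  valid (next s c) (step_elt c * lam ^+ 2).
Proof.
move=> ok [lam_gt1 lam_le gen rep].
have /andP[g_ge1 g_le] := step_elt_bounds ok.
have lam_ge0 : 0 <= lam by apply: ltW; apply: lt_trans lam_gt1.
split; last 1 first.
- apply: dlog_rep_step rep.
  by case/and5P: ok => _ _ _ /and3P[/ZtoC_gt0/gt_eqF-> _ _] _.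
- apply: lt_le_trans (_ : lam ^+ 2 <= _); first by rewrite exprn_egt1.
  by rewrite ler_peMl ?exprn_ge0.
- have -> : nat_of_bin (st_m (next s c)) = (144 + nat_of_bin (st_m s) * 2)%N.
    by rewrite [LHS]nat_of_bin_add nat_of_bin_mul addnC mulnC.
  rewrite exprD exprM ler_pM ?exprn_ge0 //; first by apply: le_trans g_ge1.
  by rewrite lerXn2r ?nnegrE ?exprn_ge0 ?ler0n.
- exact: generates_step ok gen.
Qed.

Fixpoint run (s : state) (cs : seq step) : option state :=
  if cs is c :: cs' then
    if step_ok (st_u s) (st_v s) c then run (next s c) cs' else None
  else Some s.

Lemma valid_run s cs s' lam : run s cs = Some s' -> valid s lam ->
  exists lam', valid s' lam'.
Proof.
elim: cs s lam => [|c cs IHs] s lam /=; first by case=> <-; exists lam.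
by case: ifP => // ok /IHs{}IHs /(valid_next ok)/IHs.
Qed.

(* Obtained by running the continued fraction of omega through the
   infrastructure of the principal class, doubling the distance at each step. *)
Definition chain : seq step := [::
   Step 8524673 218099 994925489700082831810149105600941071427292
     109221361518528274505563733957734363 4
     (1316260044613204281648, -109221373508678225892476944318820672,
      11990149951386913210361086309)
     (-1372847544480880914995, 113916924036919086274570330374102046,
      -12505620075313239595366613411);
   Step 5679137 1931755 141433574018023647 15526356173 72670049756929
     (-2936673, -133585, 2575068)
     (-2190887, -95820, 1917604);
   Step 13329239 6670123 6549235957848548087 718964862824 32252597064769
     (6447551, 1979902, -2724250)
     (3571578, 953241, -1435262);
   Step 10307933 6420901 1457417378608099169 159992996501 177668612319121
     (-547262, -2450708, 2460679)
     (453428, 2074593, -2076009);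
   Step 10975517 5519900 14945709791219381043 1640716605572 106253482732489
     (-1305190, -5057671, 3931957)
     (1599336, 5371484, -4269831);
   Step 8861483 4710799 3975208675308806165 436392180452 120461973417289
     (1807247, 4332356, -4267600)
     (541939, 1170113, -1182920);
   Step 15654059 6578165 3251673974887444566 356963674595 78525880959289
     (-2834478, -4019653, 3742796)
     (-67648, -72448, 74267);
   Step 13508501 8969935 60320406128981096713 6621879681406 245049563175481
     (-716470, -1094419, 1805517)
     (-74702, -414507, 488010);
   Step 11355239 6785567 220807994670097972 24239955717 182479599267001
     (-65170, -6037245, 4547322)
     (-18431, -1820923, 1370856);
   Step 4921471 1124139 2217025473754006859 243381583115 128941452747121
     (-802651, -3495535, 2906850)
     (-59338, -9699, 37213);
   Step 13085581 8421952 2772847258359144629 304398827828 24220876803841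
     (-2197657, -376846, 689522)
     (3530464, 482216, -1048457);
   Step 6654763 5364189 6485193328216489825 711934363278 171232430107561
     (234384, 2899737, -2294995)
     (-278993, -4322519, 3381836);
   Step 3181111 2026069 9935795725816238714 1090736088459 44285870586169
     (3683459, 4218234, -2718219)
     (486652, 2051416, -1046105);
   Step 15152359 6125050 76528735506250316 8401204687 10119467194321
     (4486960, 737455, -576862)
     (9059304, 1479743, -1162073);
   Step 1 0 1065355531244100060968294 116953061137122769 229593983264881
     (-8311279533, 5468539411, 2782980220)
     (75701477710196006, -49847430484793609, -25309943918908363)]%coqZ.

(** The final pair is [(1, omega)], the unit ideal, and the final [b] is 0 modulo [d]. The size
    bound is [4751216 = 2^15 + 144 * (2^15 - 1)]. *)
Lemma run_chain : run (State (2, 0)%coqZ (0, 2)%coqZ 2 0 1) chain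
  = Some (State (1, 0)%coqZ (0, 1)%coqZ 197122261645478 0 4751216).
Proof. by vm_compute. Qed.

(** * Coordinates over the square root of a prime, and powers modulo that prime *)

(** In [a^2 = p * b^2] with [b] nonzero, the [p]-adic valuations of the two sides have opposite
    parities. *)
Lemma sqrtC_prime_irrational (p : nat) (a b : int) : prime p ->
  a%:~R + b%:~R * sqrtC p%:R = 0 :> algC -> a = 0 /\ b = 0.
Proof.
move=> p_pr /eqP; rewrite addr_eq0 => /eqP ab0.
have sq : (`|a| ^ 2 = p * `|b| ^ 2)%N.
  have : (a ^+ 2)%:~R = (p%:Z * b ^+ 2)%:~R :> algC.
    by rewrite rmorphXn /= ab0 sqrrN exprMn sqrtCK rmorphM rmorphXn /= mulrC.
  by move=> /intr_inj /(congr1 absz); rewrite abszM !abszX.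
have b0 : b = 0.
  apply/eqP; rewrite -absz_eq0; apply: contraT => b_neq0.
  have b_gt0 : (0 < `|b|)%N by rewrite lt0n.
  move: sq => /(congr1 (fun n => odd (logn p n))).
  rewrite /= lognM ?(prime_gt0 p_pr) ?expn_gt0 ?b_gt0 //.
  rewrite !lognX (logn_prime _ p_pr) eqxx.
  by rewrite !mul2n oddD !odd_double.
by split=> //; move: ab0; rewrite b0 mul0r oppr0 => /eqP; rewrite intr_eq0 => /eqP.
Qed.

Lemma sqrtC_coords (p : nat) (a b a' b' : int) : prime p ->
  a%:~R + b%:~R * sqrtC p%:R = a'%:~R + b'%:~R * sqrtC p%:R :> algC ->
  a = a' /\ b = b'.
Proof.
move=> p_pr /eqP; rewrite -subr_eq0 => /eqP e.
have [] := @sqrtC_prime_irrational p (a - a') (b - b') p_pr.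
  by rewrite -e !rmorphB /=; ring.
by move=> /eqP; rewrite subr_eq0 => /eqP -> /eqP; rewrite subr_eq0 => /eqP ->.
Qed.

(* Modulo p, raising to the k-th power multiplies Y / X by k. *)
Lemma dvdz_coord_of_exp (p : nat) (z : algC) (X Y c e a b : int) (k : nat) :
    prime p -> (0 < k < p)%N -> ~~ (p %| c)%Z ->
    c%:~R * z = X%:~R + Y%:~R * sqrtC p%:R -> 
    e%:~R * z ^+ k = a%:~R + b%:~R * sqrtC p%:R ->
    ~~ (p %| a)%Z -> (p %| b)%Z -> (p %| Y)%Z.
Proof.
move=> p_pr /andP[k_gt0 k_lt] pNc zE zkE pNa p_b.
(* Binomial expansion modulo [p], where the square root of [p] squares to 0; the induction starts at
   exponent 1. *)
have powE : exists A B u v : int,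
    [/\ (X%:~R + Y%:~R * sqrtC p%:R) ^+ k
          = A%:~R + B%:~R * sqrtC p%:R :> algC,
        A = X ^+ k + p%:Z * u & B = k%:Z * X ^+ k.-1 * Y + p%:Z * v].
  case: k k_gt0 {k_lt zkE} => // k _; elim: k => [|k [A [B [u [v [e1 AE BE]]]]]].
    by exists X, Y, 0, 0; rewrite !expr1 expr0 !mulr0 !addr0 !mul1r.
  exists (A * X + p%:Z * (B * Y)), (A * Y + B * X), (u * X + B * Y), (u * Y + v * X).
  split.
  - rewrite exprSr e1 !(rmorphD, rmorphM) /=.
    move: (sqrtC p%:R) (sqrtCK (p%:R : algC)) => s s2; ring: s2.
  - by rewrite AE [X ^+ k.+2]exprSr; move: (X ^+ k.+1) => q; ring.
  - by rewrite AE BE /= exprSr -[k.+2]addn1 PoszD; move: (X ^+ k) => q; ring.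
have [A [B [u [v [powzE AE BE]]]]] := powE.
(* Both sides are the coordinates of [e * c ^ k * z ^ k]. *)
have [] := @sqrtC_coords p (c ^+ k * a) (c ^+ k * b) (e * A) (e * B) p_pr.
  rewrite !rmorphM !rmorphXn /= -!mulrA -!mulrDr -zkE -powzE -zE exprMn.
  by rewrite mulrCA.
move=> caE cbE.
have euclid (m n : int) : (p %| m * n)%Z = (p %| m)%Z || (p %| n)%Z.
  by rewrite !dvdzE abszM Euclid_dvdM.
have euclidX (m : int) l : (p %| m ^+ l)%Z -> (p %| m)%Z.
  by rewrite !dvdzE abszX Euclid_dvdX // => /andP[].
have pNca : ~~ (p %| c ^+ k * a)%Z.
  by rewrite euclid negb_or pNa andbT; apply: contra pNc => /euclidX.
(* The multiplier [e] was arbitrary; that [p] does not divide [a] forces it to be prime to [p]. *)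
have pNe : ~~ (p %| e)%Z.
  by apply: contra pNca => p_e; rewrite caE euclid p_e.
have pNX : ~~ (p %| X)%Z.
  apply: contra pNca => p_X; rewrite caE euclid AE -(prednK k_gt0) exprS.
  by rewrite rpredD ?orbT // ?dvdz_mulr.
have : (p %| e * B)%Z by rewrite -cbE euclid p_b orbT.
rewrite euclid (negbTE pNe) BE /= rpredDr; last by rewrite dvdz_mulr.
rewrite !euclid => /orP[/orP[p_k|/euclidX p_X]|//].
  by move: p_k; rewrite dvdzE /= gtnNdvd.
by rewrite p_X in pNX.
Qed.

(** * The unit [lam], and the passage from [lam] to the fundamental unit *)

Lemma ev_in_OK (x : Z * Z) : in_OK (ev x).
Proof.
have omega_int : omega \in Aint.
  pose q : {poly algC} := 'X^2 - 'X - (ZtoC mZ)%:P.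
  have size_r : (size ('X + (ZtoC mZ)%:P : {poly algC})%R
                 < size ('X^2 : {poly algC})%R)%N.
    by rewrite size_XaddC size_polyXn.
  have qE : q = 'X^2 - ('X + (ZtoC mZ)%:P) by rewrite /q opprD addrA.
  apply: (@root_monic_Aint q).
  - by rewrite rootE !hornerE sqr_omega; apply/eqP; ring.
  - by rewrite qE monicE lead_coefDl ?size_polyN // lead_coefXn.
  - apply/polyOverP=> i; rewrite !coefB coefXn coefX coefC ZtoC.unlock.
    by rewrite !rpredB ?rpred_nat //; case: ifP; rewrite ?intr_int ?rpred0.
have ZtoC_int z : ZtoC z \in Aint by rewrite ZtoC.unlock Aint_int.
split; last by apply: rpredD => //; apply: rpredM.
move=> S S_div sS.
have S_ring := GRing.divring_closedBM S_div.
have [S1 SB Sdiv] := S_div.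
have S0 : 0 \in S by rewrite -(subrr 1) SB.
have SN z : z \in S -> - z \in S by move=> zS; rewrite -[- z]add0r SB.
have SD z w : z \in S -> w \in S -> z + w \in S.
  by move=> zS wS; rewrite -[w]opprK SB ?SN.
have SM z w : z \in S -> w \in S -> z * w \in S.
  by have [_ _ SM] := S_ring; apply: SM.
have Snat n : n%:R \in S by elim: n => // n IHn; rewrite -natr1 SD.
have SZtoC z : ZtoC z \in S.
  rewrite ZtoC.unlock; case: (int_of_Z z) => n; first exact: Snat.
  by rewrite NegzE rmorphN SN ?Snat.
by apply: (SD) => //; apply: SM => //; apply: Sdiv => //; apply: SD.
Qed.

(** Starting from [lam = 2] rather than 1 makes [1 < lam] hold from the outset; squaring then
    preserves it. *)
Lemma valid_init : valid (State (2, 0)%coqZ (0, 2)%coqZ 2 0 1) 2.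
Proof.
have ZtoC2 : ZtoC 2 = 2 by exact: (ZtoC_nat 2).
split=> /=; first by rewrite ltr1n.
- by rewrite expr1.
- exists (1, 0)%coqZ, (0, 1)%coqZ, (1, 0)%coqZ, (0, 0)%coqZ.
  by rewrite /ev /= ZtoC0 ZtoC1 ZtoC2; split; ring.
- by exists 1%coqZ, 0%coqZ, 0%coqZ; rewrite ZtoC1 mul1r ZtoC2 ZtoC0 mul0r addr0.
Qed.

Lemma gtn_ndvdz (m n : nat) : (0 < n)%N -> (n < m)%N -> ~~ (m %| n%:Z)%Z.
Proof. by move=> n_gt0 n_lt; rewrite dvdzE /= gtnNdvd. Qed.

Lemma d_ndvd2 : ~~ (d %| 2%:Z)%Z.
Proof.
have lt2d : (nat_of_bin 2 < d)%N by rewrite /d nat_of_bin_lt.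
exact: (@gtn_ndvdz d 2 isT lt2d).
Qed.

Lemma exists_unit : exists2 lam : algC, unit_OK lam &
  1 < lam <= 2 ^+ nat_of_bin 4751216 /\
  exists e a b : int, [/\ e%:~R * lam = a%:~R + b%:~R * sqrtC d%:R,
    ~~ (d %| a)%Z & (d %| b)%Z].
Proof.
have [lam [lam_gt1 lam_le gen rep]] := valid_run run_chain valid_init.
exists lam.
  (* As [lam] generates the unit ideal, it lies in [Z[omega]] and the cofactor [r1] is its
     inverse. *)
  have [r1 [_ [s1 [s2 [r1E _ lamE]]]]] := gen.
  have ev1 : ev (1, 0)%coqZ = 1 by rewrite /ev /= ZtoC0 ZtoC1 mul0r addr0.
  have lamO : in_OK lam.
    by rewrite lamE -!evM -evD; apply: ev_in_OK.
  split=> //; exists (ev r1); first exact: ev_in_OK.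
  by rewrite -r1E ev1.
split; first by rewrite lam_gt1.
have [c [a [b lamE]]] := rep.
have dE : int_of_Z dZ = d%:Z.
  by apply: (@intr_inj algC); have := ZtoC_d; rewrite ZtoC.unlock.
have coordE u v : int_of_Z (u + dZ * v)%coqZ = int_of_Z u + d%:Z * int_of_Z v.
  by rewrite -dE -(rmorphM int_of_Z) -(rmorphD int_of_Z).
exists (int_of_Z c), (int_of_Z (197122261645478 + dZ * a)%coqZ).
exists (int_of_Z (0 + dZ * b)%coqZ); split.
- by rewrite -[sqrtC d%:R]/sqrtd; move: lamE; rewrite ZtoC.unlock.
- rewrite coordE rpredDr; last exact: dvdz_mulr (dvdzz _).
  have -> : int_of_Z 197122261645478 = (nat_of_bin 197122261645478)%:Z.
    by apply: (@intr_inj algC); have := ZtoC_nat 197122261645478; rewrite ZtoC.unlock.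
  apply: gtn_ndvdz.
    by rewrite -[0%N]/(nat_of_bin 0) nat_of_bin_lt.
  by rewrite nat_of_bin_lt.
- rewrite coordE add0r; exact: dvdz_mulr (dvdzz _).
Qed.

(** The minus sign would make [lam] negative and an exponent at most 0 would give [lam <= 1];
    finally [2 ^+ k <= eps ^+ k = lam <= 2 ^+ m]. *)
Lemma exp_bounded (F : numFieldType) (eps lam : F) (m : nat) :
    2 <= eps -> 1 < lam -> lam <= 2 ^+ m ->
    (exists k : int, lam = eps ^ k \/ lam = - eps ^ k) ->
  exists2 k : nat, lam = eps ^+ k & (0 < k <= m)%N.
Proof.
move=> eps_ge2 lam_gt1 lam_le [k lamE].
have eps_gt1 : 1 < eps by apply: lt_le_trans eps_ge2; rewrite ltr1n.
have eps_gt0 : 0 < eps by apply: lt_trans eps_gt1.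
case: lamE => [lamE|lamE]; last first.
  have : 0 < lam by apply: lt_trans lam_gt1.
  by rewrite lamE oppr_gt0 => /lt_gtF; rewrite exprz_gt0.
case: k lamE => k lamE; last first.
  have /lt_geF/negP[] := lam_gt1; rewrite lamE NegzE -exprz_inv.
  by apply: exprn_ile1; rewrite ?invr_ge0 ?invf_le1 // ltW.
exists k => //; apply/andP; split.
  by case: k lamE lam_gt1 => // ->; rewrite expr0z ltxx.
have : (2 : F) ^+ k <= 2 ^+ m.
  apply: le_trans lam_le; rewrite lamE.
  by rewrite lerXn2r ?nnegrE ?ler0n // ltW.
by rewrite ler_eXn2l ?ltr1n.
Qed.

Theorem theorem2p3 :
  [/\ (d = 1 %[mod 4])%N,
      prime d &
      forall (eps : algC) (x y : nat),
        fundamental_unit eps -> eps = x%:R + y%:R * omega -> (d %| y)%N].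
Proof.
split=> [||eps x y [_ eps_gt1 unitsE] epsE]; [exact: d_mod4 | exact: prime_d |].
have [y0|y_gt0] := posnP y; first by rewrite y0 dvdn0.
(* With [y] positive, [eps] is at least [omega]. *)
have eps_ge2 : 2 <= eps.
  rewrite epsE (le_trans omega_ge2) //.
  have omega_ge0 : 0 <= omega by apply: le_trans omega_ge2.
  by rewrite -[leLHS]add0r lerD ?ler0n // ler_peMl // ler1n.
have [lam lam_unit [/andP[lam_gt1 lam_le] [e [a [b [lamE dNa d_b]]]]]] := exists_unit.
have [k lam_eps /andP[k_gt0 k_le]] :=
  exp_bounded eps_ge2 lam_gt1 lam_le ((unitsE lam).1 lam_unit).
have k_lt : (k < d)%N by apply: leq_ltn_trans k_le _; rewrite /d nat_of_bin_lt.
(* The coordinates come from [2 * eps = (2 x + y) + y * sqrtd]. *)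
have := @dvdz_coord_of_exp d eps (2 * x + y)%N%:Z y%:Z 2%:Z e a b k prime_d.
rewrite k_gt0 k_lt => /(_ isT); apply.
- exact: d_ndvd2.
- rewrite epsE -/sqrtd /omega -!pmulrn natrD natrM.
  by move: sqrtd => s; field.
- by rewrite -lamE lam_eps.
- exact: dNa.
- exact: d_b.
Qed.
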